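(* Let $\alpha\in(0,1)$. If $(X,f)$ is an $E$-system with the $\mathscr{M}_{\alpha}$-shadowing property, then $(X,f)$ is weakly mixing.
   Context: $\mathbb{N}=\{1,2,3,\ldots\}$ and $\mathbb{N}_0=\{0,1,2,\ldots\}$. A dynamical system is a pair $(X,f)$ where $(X,d)$ is a compact metric space and $f\colon X\to X$ is a continuous surjection. Transitivity notions: for $A,B\subseteq X$, $N_f(A,B)=\{n\in\mathbb{N}: f^n(A)\cap B\neq\varnothing\}$. $(X,f)$ is transitive if $N_f(U,V)\neq\varnothing$ for all nonempty open $U,V\subseteq X$; it is weakly mixing if $(X\times X,f\times f)$ is transitive. $\mathcal{M}(X,f)$ is the set of $f$-invariant Borel probability measures on $X$; $\operatorname{supp}(\mu)$ is the set of $x\in X$ with $\mu(U)>0$ for every open neighborhood $U$ of $x$; $\mu$ has full support if $\operatorname{supp}(\mu)=X$. $(X,f)$ is an $E$-system if it is transitive and some $\mu\in\mathcal{M}(X,f)$ has full support. Density and shadowing: for $A\subseteq\mathbb{N}_0$, $\underline{\mathrm{Dens}}(A)=\liminf_{n\to\infty}\frac{\#(A\cap\{0,\ldots,n\})}{n+1}$. For $\alpha\in[0,1)$, $\mathscr{M}_\alpha$ is the family of all $A\subseteq\mathbb{N}_0$ with $\underline{\mathrm{Dens}}(A)>\alpha$. For $\delta>0$, a sequence $\{x_i\}_{i=0}^\infty\subseteq X$ is a $\delta$-ergodic pseudo-orbit if $\lim_{n\to\infty}\frac{1}{n}\#\{0\le i<n: d(f(x_i),x_{i+1})\ge\delta\}=0$.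 $(X,f)$ has the $\mathscr{M}_\alpha$-shadowing property if for every $\varepsilon>0$ there is $\delta>0$ such that for every $\delta$-ergodic pseudo-orbit $\{x_i\}_{i=0}^\infty$ there is $z\in X$ with $\{j\in\mathbb{N}_0: d(f^j(z),x_j)<\varepsilon\}\in\mathscr{M}_\alpha$. *)

(* Defs.v *)
From HB Require Import structures.
From mathcomp Require Import all_boot all_order all_algebra.
From mathcomp Require Import all_classical all_reals all_analysis.

Set Implicit Arguments.
Unset Strict Implicit.
Unset Printing Implicit Defensive.

Import Order.TTheory GRing.Theory Num.Theory.
Import numFieldNormedType.Exports.

Local Open Scope classical_set_scope.
Local Open Scope ring_scope.

(* Measurable types are pointed in MathComp-Analysis, so the Borel sets of a
   metric space form a measurable type only when the space has a base point.
   Every space carrying a probability measure is nonempty, so this loses no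
   generality for E-systems; no definition below refers to the base point. *)
#[short(type="pmetricType")]
HB.structure Definition PointedMetric (K : numDomainType) :=
  {M of Metric K M & Pointed M}.

Definition dynamical_system (R : realType) (X : metricType R) (f : X -> X) :=
  [/\ compact [set: X], continuous f & set_surj [set: X] [set: X] f].

Definition hitting_times (T : Type) (f : T -> T) (A B : set T) : set nat :=
  [set n | (0 < n)%N /\ (iter n f @` A) `&` B !=set0].

Definition transitive_map (T : topologicalType) (f : T -> T) :=
  forall U V : set T, open U -> U !=set0 -> open V -> V !=set0 ->
    hitting_times f U V !=set0.

Definition weakly_mixing (T : topologicalType) (f : T -> T) :=
  transitive_map (fun p : T * T => (f p.1, f p.2)).

Definition borel (T : ptopologicalType) := g_sigma_algebraType (@open T).

Definition invariant_measures (R : realType) (T : ptopologicalType)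
    (f : T -> T) : set (probability (borel T) R) :=
  [set mu | forall A : set (borel T), measurable A -> mu (f @^-1` A) = mu A].

Definition measure_supp (R : realType) (T : ptopologicalType)
    (mu : probability (borel T) R) : set T :=
  [set x | forall U : set T, open_nbhs x U -> (0 < mu U)%E].

Definition E_system (R : realType) (X : pmetricType R) (f : X -> X) :=
  transitive_map f /\
  exists2 mu : probability (borel X) R,
    invariant_measures f mu & measure_supp mu = [set: X].

Definition count_below (A : set nat) (n : nat) : nat :=
  #|[pred i : 'I_n | (i : nat) \in A]|.

(* The sequence has values in [0, 1], so the real-valued limn_inf is the
   actual limit inferior. *)
Definition lower_density (R : realType) (A : set nat) : R :=
  limn_inf (fun n => (count_below A n.+1)%:R / n.+1%:R : R^o).

Definition dense_family (R : realType) (alpha : R) : set (set nat) :=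
  [set A | alpha < lower_density R A].

Definition ergodic_pseudo_orbit (R : realType) (X : metricType R)
    (f : X -> X) (delta : R) (x : nat -> X) :=
  (fun n => (count_below [set i | delta <= mdist (f (x i)) (x i.+1)] n)%:R
            / n%:R : R) @ \oo --> (0 : R).

Definition dense_shadowing (R : realType) (X : metricType R) (alpha : R)
    (f : X -> X) :=
  forall eps : R, 0 < eps -> exists2 delta : R, 0 < delta &
    forall x : nat -> X, ergodic_pseudo_orbit f delta x ->
      exists z : X,
        dense_family alpha [set j | mdist (iter j f z) (x j) < eps].

(* Main.v *)
Require Import Defs.
From HB Require Import structures.
From mathcomp Require Import all_boot all_order all_algebra.
From mathcomp Require Import all_classical all_reals all_analysis.
From mathcomp Require Import measurable_realfun.
From mathcomp Require Import zify lra.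

Set Implicit Arguments.
Unset Strict Implicit.
Unset Printing Implicit Defensive.

Import Order.TTheory GRing.Theory Num.Theory.
Import numFieldNormedType.Exports.

Local Open Scope classical_set_scope.
Local Open Scope ring_scope.

(** Write N(A, B) for the hitting times of f from A to B.  Two facts give the
    theorem.

    First, a transitive continuous surjection is weakly mixing as soon as every
    nonempty open set W satisfies: for every k there is n with both n and n + k
    in N(W, W) ([weakly_mixing_of_return_differences]).  Indeed, for k in
    N(U, V) and W = U `&` f^-k V, such an n gives n + k in both N(U, U) and
    N(U, V); three further manipulations with transitivity turn this into a
    common element of N(A, B) and N(C, D) for arbitrary A, B, C, D.

    Second, shadowing produces such an n ([return_time_differences]).  Choose a
    point a whose orbit visits a slightly smaller open set W' with bounded gaps,
    outside a set B of times that has frequency less than alpha / 2 in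
    infinitely many initial segments of the integers ([good_orbit]).  Such a
    point exists because the invariant measure gives W' positive mass: almost
    every point of W' returns infinitely often, hence within M steps up to a
    small measure, and Fatou's lemma turns this smallness in measure into
    smallness along one orbit ([exists_seldom_visiting]).  Now cut time into
    blocks, each much longer than all the earlier ones together, and consider
    the pseudo-orbit that follows the orbit of a on the even blocks and the same
    orbit k steps ahead on the odd blocks.  Its jumps have density zero.  A
    point z that follows it along a set J of lower density greater than alpha
    must, in every late block, do so at some time outside B, because the block
    fills almost all of the time elapsed so far ([dense_family_meets_blocks]).
    So z visits W at a time q at which the orbit of a does too (even block), and
    at a later time q' such that the orbit of a visits W at time q' + k (odd
    block).  Then n = q' - q is a return time of W, thanks to z, and n + k is
    one, thanks to a. *)

(** * Counting and density of sets of times *)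

Lemma count_belowS (A : set nat) n :
  count_below A n.+1 = (count_below A n + (n \in A))%N.
Proof.
rewrite /count_below -!sum1_card !(big_mkcond (fun i => i \in _)).
rewrite big_ord_recr /=; congr addn.
Qed.

Lemma count_below0 (A : set nat) : count_below A 0 = 0%N.
Proof. by rewrite /count_below; apply: eq_card0 => -[]. Qed.

Lemma count_below_le (A : set nat) n : (count_below A n <= n)%N.
Proof.
by elim: n => [|n ih]; rewrite ?count_below0// count_belowS; case: (n \in A); lia.
Qed.

Lemma count_below_sub_from (A B : set nat) s n :
  (forall j, (s <= j < n)%N -> A j -> B j) ->
  (count_below A n <= s + count_below B n)%N.
Proof.
elim: n => [|n ih] AB; first by rewrite count_below0.
have {ih} ih : (count_below A n <= s + count_below B n)%N.
  by apply: ih => j jn; apply: AB; lia.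
rewrite !count_belowS.
have [sn|ns] := leqP s n; last first.
  have := count_below_le A n; case: (n \in A); lia.
have [/set_mem An|] := boolP (n \in A); last by lia.
by rewrite (mem_set (AB n _ An)); lia.
Qed.

Lemma dense_family_eventually (R : realType) (A : set nat) (alpha : R) :
  dense_family alpha A ->
  exists N, forall n, (N < n)%N -> alpha * n%:R < (count_below A n)%:R.
Proof.
rewrite /dense_family /lower_density/=; set u := fun n => _.
have u01 n : 0 <= u n <= 1.
  rewrite /u divr_ge0//= ler_pdivrMr ?ltr0n// mul1r ler_nat.
  exact: count_below_le.
have ubu : has_ubound (range u) by exists 1 => _ [n _ <-]; case/andP: (u01 n).
have lbu : has_lbound (range u) by exists 0 => _ [n _ <-]; case/andP: (u01 n).
have cu := cvg_infs_sup ubu lbu.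
rewrite /limn_inf (cvg_lim _ cu)// => au.
have [_ [N _ <-] aN] : exists2 y, range (infs u) y & alpha < y.
  by apply: sup_gt au => //; exists (infs u 0%N), 0%N.
exists N.+1 => n Nn; case: n Nn => // n Nn.
rewrite -ltr_pdivlMr ?ltr0n//; apply: (lt_le_trans aN).
apply: ge_inf; last by exists n => //=; rewrite ltnS in Nn; exact: ltnW.
exact: has_lbound_sdrop.
Qed.

Lemma sqr_count_cvg0 (R : realType) (A : set nat) :
  (forall n, (count_below A n ^ 2 <= n)%N) ->
  (fun n => (count_below A n)%:R / n%:R : R) @ \oo --> (0 : R).
Proof.
move=> An; apply/cvgrPdist_le => e e0; near=> n.
have n0 : 0 < n%:R :> R by rewrite ltr0n; near: n; exact: nbhs_infty_gt.
have en : (e * e)^-1 <= n%:R by near: n; exact: nbhs_infty_ger.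
rewrite sub0r normrN ger0_norm ?divr_ge0// ler_pdivrMr//.
have := An n; rewrite -(ler_nat R) natrX; set c := _%:R => cn.
have : 1 <= e * e * n%:R by rewrite -ler_pdivrMl ?mulr_gt0// mulr1.
move=> en1; rewrite leNgt; apply/negP => ce.
have en0 : 0 <= e * n%:R by rewrite mulr_ge0// ltW.
have n_le : n%:R <= (e * n%:R) * (e * n%:R).
  by rewrite mulrACA mulrA (ler_peMl (ltW n0) en1).
have : (e * n%:R) * (e * n%:R) < c ^+ 2 by rewrite expr2 ltr_pM.
by rewrite ltNge (le_trans cn).
Unshelve. all: by end_near. Qed.

(** * Orbits that avoid small sets *)

(** The integral over L of the visiting frequency count / n is at most c for
    every n.  If every point of L had frequencies eventually at least beta,
    Fatou's lemma would bound beta * mu L by c.  In this way a point with low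
    frequencies along a subsequence is found without a pointwise ergodic
    theorem. *)
Lemma exists_seldom_visiting d (T : measurableType d) (R : realType)
    (mu : {measure set T -> \bar R}) (L : set T) (A : nat -> set T) (beta c : R) :
  measurable L -> (forall i, measurable (A i)) ->
  (forall i, mu (A i) <= c%:E)%E -> (c%:E < beta%:E * mu L)%E ->
  exists2 x, L x & forall N, exists2 n, (N < n)%N &
    (count_below [set i | A i x] n)%:R < beta * n%:R.
Proof.
move=> mL mA Ac cb.
have c0 : 0 <= c by rewrite -lee_fin (le_trans _ (Ac 0%N)).
have beta0 : 0 <= beta.
  rewrite leNgt; apply/negP => b0; move: cb; apply/negP; rewrite -leNgt.
  by rewrite (@le_trans _ _ 0%E) ?lee_fin// mule_le0_ge0// lee_fin ltW.
apply: contrapT => noX.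
pose g n (x : T) : \bar R :=
  ((n.+1%:R^-1)%:E * \sum_(i < n.+1) (\1_(A i) x)%:E)%E.
have gE n x : g n x = ((count_below [set i | A i x] n.+1)%:R / n.+1%:R)%:E.
  rewrite /g sumEFin -EFinM mulrC; congr (_ / _)%:E.
  elim: n.+1 => [|m ih]; first by rewrite big_ord0 count_below0.
  by rewrite big_ord_recr/= ih count_belowS natrD indicE !unfold_in.
have mg n : measurable_fun L (g n).
  apply: measurable_funeM; apply: emeasurable_sum => i.
  by apply/measurable_EFinP; exact: measurable_indic.
have g0 n x : L x -> (0 <= g n x)%E by move=> _; rewrite gE lee_fin divr_ge0.
have int_g n : (\int[mu]_(x in L) g n x <= c%:E)%E.
  rewrite ge0_integralZl ?lee_fin//; last 2 first.
  - by apply: emeasurable_sum => i; apply/measurable_EFinP; exact: measurable_indic.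
  - by move=> x _; apply: sume_ge0 => i _; rewrite lee_fin.
  rewrite ge0_integral_sum//; last first.
    by move=> i; apply/measurable_EFinP; exact: measurable_indic.
  rewrite lee_pdivrMl ?ltr0n//.
  apply: (@le_trans _ _ (\sum_(i < n.+1) c%:E)%E).
    apply: lee_sum => i _; rewrite integral_indic//.
    by apply: le_trans (Ac i); rewrite le_measure ?inE//; exact: measurableI.
  by rewrite sumEFin lee_fin sumr_const card_ord mulr_natl.
suff : (limn_einf (fun n => \int[mu]_(x in L) g n x) <
        \int[mu]_(x in L) limn_einf (g ^~ x))%E.
  by rewrite ltNge (fatou mu mL mg g0).
apply: (@le_lt_trans _ _ c%:E).
  rewrite limn_einf_lim; apply: lime_le; first exact: is_cvg_einfs.
  apply: nearW => n; apply: le_trans (int_g n).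
  by apply: ereal_inf_lbound; exists n => /=.
apply: (lt_le_trans cb); rewrite -integral_cst//.
apply: ge0_le_integral => //.
- apply: measurableT_comp => //; apply: measurable_fun_limn_esup => n.
  exact: measurableT_comp.
- move=> x Lx; rewrite limn_einf_lim; apply: lime_ge; first exact: is_cvg_einfs.
  have [N hN] : exists N, forall n, (N < n)%N ->
      beta * n%:R <= (count_below [set i | A i x] n)%:R.
    apply: contrapT => hN; apply: noX; exists x => // N.
    apply: contrapT => hN'; apply: hN; exists N => n Nn.
    by rewrite leNgt; apply/negP => lt; apply: hN'; exists n.
  exists N => // n /= Nn; apply: le_ereal_inf_tmp => _ [m /= nm <-].
  by rewrite gE lee_fin ler_pdivlMr ?ltr0n//; apply: hN; lia.
Qed.

Lemma continuous_iter (T : topologicalType) (f : T -> T) n :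
  continuous f -> continuous (iter n f).
Proof.
move=> cf; elim: n => [|n ih] x; first exact: cvg_id.
exact: (continuous_comp (ih x) (@cf _)).
Qed.

Section invariant_measure.
Context {R : realType} {T : ptopologicalType} (f : T -> T).
Hypothesis cf : continuous f.

Lemma open_measurable_borel (U : set T) : open U -> measurable (U : set (borel T)).
Proof. exact: sub_sigma_algebra. Qed.

Lemma continuous_measurable_borel (g : T -> T) : continuous g ->
  measurable_fun setT (g : borel T -> borel T).
Proof.
move=> cg; apply: (@measurability _ _ (borel T) (borel T) setT g open) => //.
move=> _ [U oU <-]; rewrite setTI; apply: open_measurable_borel.
by move/continuousP: cg; exact.
Qed.

Lemma measurable_iter_preimage n (A : set (borel T)) :
  measurable A -> measurable (iter n f @^-1` A : set (borel T)).
Proof.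
move=> mA; rewrite -[_ @^-1` _]setTI.
exact: (continuous_measurable_borel (@continuous_iter _ _ n cf) measurableT mA).
Qed.

Lemma invariant_iter (mu : probability (borel T) R) n (A : set (borel T)) :
  invariant_measures f mu -> measurable A -> mu (iter n f @^-1` A) = mu A.
Proof.
move=> mui mA; elim: n => [//|n ih]; rewrite -ih.
rewrite -(mui (iter n f @^-1` A)); last exact: measurable_iter_preimage.
by congr (mu _); apply/seteqP; split => x /=; rewrite -iterS iterSr.
Qed.

(** The measure mu is finite, so continuity from above applies twice.  The set L
    of points that visit W infinitely often has at least the mass of W, although
    L may fail to have full measure when mu is not ergodic.  The points of L
    with no visit at the times k, ..., k + M form sets G M that decrease to the
    empty set, so that mu (G M) < beta * mu L for some M.  Since L is invariant
    and mu (f^-i (G M)) = mu (G M), [exists_seldom_visiting] applies on L.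
    Visits are required after at least k steps so that they can be shifted back
    by k. *)
Lemma good_orbit (mu : probability (borel T) R) (W : set T) (beta : R) k :
  invariant_measures f mu -> open W -> (0 < mu W)%E -> 0 < beta ->
  exists a M, forall N, exists2 n, (N < n)%N &
    (count_below [set j | ~ exists2 m, (k <= m <= k + M)%N &
                            W (iter (j + m) f a)] n)%:R < beta * n%:R.
Proof.
move=> mui oW muW beta0.
have mW := open_measurable_borel oW.
pose F i : set (borel T) := iter i f @^-1` W.
have mF i : measurable (F i) by exact: measurable_iter_preimage.
pose L := lim_sup_set F.
have mU n : measurable (\bigcup_(i >= n) F i : set (borel T)).
  exact: bigcup_measurable.
have mL : measurable L by apply: bigcap_measurable => // n _; exact: mU.
have muL : (mu W <= mu L)%E.
  have cL := lim_sup_set_cvg mu F mF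
    (le_lt_trans (probability_le1 mu (mU 0%N)) (ltry 1)).
  rewrite -(cvg_lim _ cL)//; apply: lime_ge; first by apply/cvg_ex; exists (mu L).
  apply: nearW => n; rewrite -(invariant_iter n mui mW).
  apply: le_measure; rewrite ?inE; [exact: mF|exact: mU|].
  by move=> x Fx; exists n => /=.
have Liter x i : L x -> L (iter i f x).
  move=> Lx n _; have [j nj] := Lx (n + i)%N I.
  rewrite /F /= => Wj; exists (j - i)%N; first by rewrite /= in nj *; lia.
  by rewrite /F /= -iterD subnK//; rewrite /= in nj; lia.
pose G M : set (borel T) :=
  L `&` \bigcap_(m in [set m | (k <= m <= k + M)%N]) ~` F m.
have mG M : measurable (G M).
  apply: measurableI => //; apply: bigcap_measurable => [|m _].
    by exists k => /=; rewrite leqnn leq_addr.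
  exact: measurableC.
have capG : \bigcap_M G M = set0.
  rewrite -subset0 => x Gx; have [Lx _] := Gx 0%N I.
  have [j /= kj Fj] := Lx k I; have [_ /(_ j)] := Gx j I.
  by apply => //=; rewrite kj leq_addl.
have cG : (mu \o G) n @[n --> \oo] --> 0%E.
  rewrite -(measure0 mu) -capG; apply: nonincreasing_cvg_mu => //.
  - exact: le_lt_trans (probability_le1 mu (mG 0%N)) (ltry 1).
  - by rewrite capG.
  - move=> m n mn; apply/subsetPset => x [Lx Gx]; split => // i /= /andP[ki im].
    by apply: Gx; rewrite /= ki (leq_trans im)// leq_add2l.
have [M muG] : exists M, (mu (G M) < beta%:E * mu L)%E.
  have bL : (0 < beta%:E * mu L)%E by rewrite mule_gt0 ?lte_fin// (lt_le_trans muW).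
  apply: contrapT => /forallNP noM; move: bL; apply/negP; rewrite -leNgt.
  rewrite -(cvg_lim _ cG)//; apply: lime_ge; first by apply/cvg_ex; exists 0%E.
  by apply: nearW => M; rewrite leNgt; apply/negP; exact: noM.
have fG : mu (G M) \is a fin_num by exact: fin_num_measure.
have [||a La aN] := @exists_seldom_visiting _ _ R mu L (fun i => iter i f @^-1` G M)
    beta (fine (mu (G M))) mL (fun i => measurable_iter_preimage i (mG M)).
- move=> i; rewrite fineK//. by rewrite -[leRHS](invariant_iter i mui (mG M)). 
- by rewrite fineK.
exists a, M => N; have [n Nn an] := aN N; exists n => //.
rewrite [X in count_below X](_ : _ = [set i | (iter i f @^-1` G M) a])//.
apply/seteqP; split => j /=.
  move=> noW; split; first exact: Liter.
  move=> m /= km Fm; apply: noW; exists m => //.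
  by rewrite addnC iterD.
move=> [_ Gj] [m km]; rewrite addnC iterD => Wm.
exact: Gj km Wm.
Qed.
End invariant_measure.

(** * Division of time into blocks *)

Section blocks.
Variable t : nat -> nat.
Hypotheses (t0 : t 0 = 0%N) (t_incr : forall s, (t s < t s.+1)%N).

(** The s with t s <= j < t s.+1, computed step by step because at most one
    block can begin at each time. *)
Fixpoint block_index j : nat :=
  if j is i.+1 then (block_index i + (t (block_index i).+1 <= i.+1))%N else 0%N.

#[local] Arguments block_index : simpl never.

Lemma block_indexS j : block_index j.+1 =
  (block_index j + (t (block_index j).+1 <= j.+1))%N.
Proof. by []. Qed.

Lemma block_indexP j : (t (block_index j) <= j < t (block_index j).+1)%N.
Proof.
elim: j => [|j /andP[lo hi]]; first by have := t_incr 0; rewrite /= t0.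
rewrite block_indexS; case: (leqP (t (block_index j).+1) j.+1) => tj.
  by rewrite addn1 tj/= (leq_ltn_trans hi (t_incr _)).
by rewrite addn0 tj andbT; lia.
Qed.

Lemma block_index_eq s j : (t s <= j < t s.+1)%N -> block_index j = s.
Proof.
have tm : {homo t : m n / (m <= n)%N}.
  by apply: homo_leq => //[m n p|n]; [exact: leq_trans|exact: ltnW].
move=> sj; have hj := block_indexP j.
by case: (ltngtP (block_index j) s) => // /tm; lia.
Qed.

Lemma count_block_changes n :
  count_below [set i | block_index i != block_index i.+1] n = block_index n.
Proof.
elim: n => [|n ih]; first by rewrite count_below0.
rewrite count_belowS ih [RHS]block_indexS; congr (_ + nat_of_bool _)%N.
apply/idP/idP => [/set_mem|tn]; last apply/mem_set;
  rewrite mksetE block_indexS.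
  by case: (t _ <= _)%N => //; rewrite addn0 eqxx.
by rewrite tn; lia.
Qed.
End blocks.
Arguments block_index : simpl never.

(** Take t s.+1 so large that t s is at most alpha / 2 * t s.+1, and such that
    fewer than alpha / 2 * t s.+1 of the times before t s.+1 lie in B.  The times
    before t s together with those in B are then too few to contain J before
    t s.+1.  The block ends depend on B only, as they have to be fixed before J
    is known.  The bound s ^ 2 <= t s makes the ends of the blocks a set of
    density zero. *)
Lemma dense_family_meets_blocks (R : realType) (alpha : R) (B : set nat) :
  0 < alpha ->
  (forall N, exists2 n, (N < n)%N & (count_below B n)%:R < alpha / 2 * n%:R) ->
  exists t : nat -> nat, [/\ t 0 = 0%N, forall s, (t s < t s.+1)%N,
    forall s, (s ^ 2 <= t s)%N &
    forall J, dense_family alpha J -> exists S, forall s, (S <= s)%N ->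
      exists j, [/\ (t s <= j < t s.+1)%N, J j & ~ B j]].
Proof.
move=> a0 Bn.
pose next N : nat := projT1 (cid2 (Bn N)).
have nextP N : (N < next N)%N /\
    (count_below B (next N))%:R < alpha / 2 * (next N)%:R.
  by rewrite /next; case: cid2.
have [C Ca] : exists C : nat, 2 / alpha < C%:R.
  by exists (Num.truncn (2 / alpha)).+1; rewrite truncnS_gt.
pose t := fix t s : nat :=
  if s is r.+1 then next (t r * C + t r + r.+1 ^ 2)%N else 0%N.
have tS s : (t s * C + t s + s.+1 ^ 2 < t s.+1)%N.
  by case: (nextP (t s * C + t s + s.+1 ^ 2)%N).
exists t; split => //.
- by move=> s; have := tS s; lia.
- by case=> // s; have := tS s; lia.
have t_ge s : (s <= t s)%N by elim: s => // s ih; have := tS s; lia.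
move=> J /dense_family_eventually[N JN]; exists N => s Ns.
apply: contrapT => noj.
have JB : (count_below J (t s.+1) <= t s + count_below B (t s.+1))%N.
  apply: count_below_sub_from => j sj Jj; apply: contrapT => nBj.
  by apply: noj; exists j.
have Jt := JN (t s.+1) (leq_ltn_trans Ns (t_ge s.+1)).
have [_ Bt] := nextP (t s * C + t s + s.+1 ^ 2)%N.
rewrite -[next _]/(t s.+1) in Bt.
have Ct : (t s)%:R * C%:R <= (t s.+1)%:R :> R.
  by rewrite -natrM ler_nat; have := tS s; lia.
have ts : (t s)%:R <= alpha / 2 * (t s.+1)%:R.
  rewrite -ler_pdivrMl ?divr_gt0// invf_div (le_trans _ Ct)// mulrC.
  by rewrite ler_wpM2l// ltW.
move: JB; rewrite -(ler_nat R) natrD; lra.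
Qed.

(** * Uniform continuity of iterates *)

Lemma compact_unif_continuous (R : realType) (X : pseudoMetricType R) (g : X -> X) r :
  compact [set: X] -> continuous g -> 0 < r ->
  exists2 e, 0 < e & forall x y, ball x e y -> ball (g x) r (g y).
Proof.
move=> /compact_near_coveringP cX cg r0.
have : \forall e \near 0^'+,
    [set: X] `<=` [set x | forall y, ball x e y -> ball (g x) r (g y)].
  apply: cX => x _.
  have [d /= d0 xd] : nbhs_ball x (g @^-1` ball (g x) (r / 2)).
    by apply/nbhs_ballP/cg/nbhsx_ballx; rewrite divr_gt0.
  exists (ball x (d / 2), [set e | e < d / 2]).
    split; first by apply: nbhsx_ballx; rewrite divr_gt0.
    by apply: nbhs_right_lt; rewrite divr_gt0.
  move=> [x' e] [/= xx' ed] y x'y.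
  have close u : ball x d u -> ball (g x) (r / 2) (g u) by exact: xd.
  apply: (@ball_splitr _ _ (g x)).
    by apply/close/(le_ball _ xx'); lra.
  apply: close; rewrite [d]splitr; apply: (ball_triangle xx').
  exact: le_ball (ltW ed) _ x'y.
move=> cov; have [e [e0 he]] : exists e, 0 < e /\
    [set: X] `<=` [set x | forall y, ball x e y -> ball (g x) r (g y)].
  near (0 : R)^'+ => e; exists e; split; first by [].
  by near: e; exact: cov.
by exists e => // x; exact: (he x I).
Unshelve. all: by end_near. Qed.

Lemma compact_unif_iter (R : realType) (X : pseudoMetricType R) (f : X -> X) N r :
  compact [set: X] -> continuous f -> 0 < r ->
  exists2 e, 0 < e & forall x y, ball x e y ->
    forall m, (m <= N)%N -> ball (iter m f x) r (iter m f y).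
Proof.
move=> cX cf r0; elim: N => [|N [e e0 ih]].
  by exists r => // x y xy [|].
have [e' e'0 he'] := compact_unif_continuous cX cf e0.
exists (Num.min r e'); first by rewrite lt_min r0 e'0.
move=> x y xy [_|m mN]; first by apply: le_ball xy; rewrite ge_min lexx.
rewrite !iterSr; apply: ih => //; apply: he'; apply: le_ball xy.
by rewrite ge_min lexx orbT.
Qed.

(** * Return times from shadowing *)

Lemma hitting_timesP (T : Type) (f : T -> T) (A B : set T) n :
  hitting_times f A B n <-> (0 < n)%N /\ exists2 x, A x & B (iter n f x).
Proof.
split=> -[n0]; first by move=> [_ [[x Ax <-] Bx]]; split => //; exists x.
by move=> [x Ax Bx]; split => //; exists (iter n f x); split => //; exists x.
Qed.

(** Both n and n + k are differences of visiting times along one orbit: n along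
    the orbit of the shadowing point z, which visits W in an even block and in a
    later odd one, and n + k along the orbit of a, which the pseudo-orbit
    follows k steps ahead in the odd block only. *)
Lemma return_time_differences (R : realType) (X : pmetricType R) (f : X -> X)
    (alpha : R) (mu : probability (borel X) R) (W : set X) k :
  0 < alpha -> compact [set: X] -> continuous f -> dense_shadowing alpha f ->
  invariant_measures f mu -> measure_supp mu = [set: X] ->
  open W -> W !=set0 ->
  exists n, hitting_times f W W n /\ hitting_times f W W (n + k).
Proof.
move=> a0 cX cf sh mui mus oW [w Ww].
have [r /= r0 wr] : nbhs_ball w W by apply/nbhs_ballP; exact: open_nbhs_nbhs.
pose W' := (ball w (r / 2))°.
have r20 : 0 < r / 2 by rewrite divr_gt0.
have muW' : (0 < mu W')%E.
  have : measure_supp mu w by rewrite mus.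
  by apply; exact: (@open_nbhs_ball _ _ w (PosNum r20)).
have W'W x y : W' x -> ball x (r / 2) y -> W y.
  move=> /interior_subset wx xy; apply: wr; rewrite [r]splitr.
  exact: ball_triangle wx xy.
have [a [M aM]] :=
  good_orbit cf k mui (@open_interior _ _) muW' (divr_gt0 a0 (ltr0Sn R 1)).
have [e e0 ef] := compact_unif_iter (k + M) cX cf r20.
have [d d0 shd] := sh e e0.
have [t [t0 tS tsq meets]] := dense_family_meets_blocks a0 aM.
(* The point a is followed on the even blocks, and f^k a on the odd ones. *)
pose x j := iter (j + k * odd (block_index t j)) f a.
have px : ergodic_pseudo_orbit f d x.
  apply: squeeze_cvgr (cvg_cst 0) (@sqr_count_cvg0 R
    [set i | block_index t i != block_index t i.+1] _).
    apply: nearW => n; rewrite divr_ge0//= ler_wpM2r// ler_nat.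
    apply: (@count_below_sub_from _ _ 0) => j _ /= dj; apply/eqP => bj.
    have xS : x j.+1 = f (x j) by rewrite [LHS]/x -bj.
    by move: dj; rewrite xS mdistxx leNgt d0.
  move=> n; rewrite count_block_changes// (leq_trans (tsq _))//.
  by case/andP: (block_indexP t0 tS n).
have [z Jz] := shd x px.
have [S hS] := meets _ Jz.
(* From the shadowing time j the orbit of a reaches W' after m steps, with
   k <= m <= k + M, and uniform continuity transfers this visit to z, but k steps
   earlier on an odd block, where x j is f^k applied to f^j a. *)
have shadow s : (S <= s)%N -> exists j m, [/\ (s <= j)%N, (k <= m)%N,
    W' (iter (j + m) f a) & W (iter (j + m - k * odd s) f z)].
  move=> Ss; have [j [tj /= zj nB]] := hS s Ss.
  have [m /andP[km mM] W'm] : exists2 m, (k <= m <= k + M)%N & W' (iter (j + m) f a).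
    by apply: contrapT; exact: nB.
  have sj : (s <= j)%N.
    by have := tsq s; have /andP[] := tj; case: (s) => // s'; nia.
  have ks : (k * odd s <= m)%N by case: odd; rewrite ?muln0 ?muln1.
  exists j, m; split => //; apply: (W'W _ _ W'm).
  rewrite addnC -addnBAC// [in X in ball _ _ X]iterD.
  have -> : iter (m + j) f a = iter (m - k * odd s) f (x j).
    by rewrite /x (block_index_eq t0 tS tj) -iterD; congr iter; lia.
  apply: ef; first by apply: ball_sym; rewrite ballEmdist.
  exact: leq_trans (leq_subr _ _) mM.
have W'_W y : W' y -> W y by move=> /W'W; apply; exact: ballxx.
have [|j [m [_ _ a_jm z_jm]]] := shadow (2 * S)%N; first by lia.
(* A block of index larger than j + m starts after the time j + m. *)
have [|i [p [ji kp a_ip z_ip]]] := shadow (2 * (S + j + m)).+1; first by lia.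
move: z_jm z_ip; rewrite /= !oddM/= muln0 muln1 subn0 => z_jm z_ip.
exists (i + p - k - (j + m))%N; split; apply/hitting_timesP.
  split; first by lia.
  by exists (iter (j + m) f z) => //; rewrite -iterD subnK//; lia.
split; first by lia.
exists (iter (j + m) f a); first exact: W'_W.
by rewrite -iterD [X in iter X](_ : _ = i + p)%N; [exact: W'_W|lia].
Qed.

(** * Weak mixing from return times *)

(** Each step below enlarges the class of pairs of hitting-time sets known to
    meet: N(U, U) and N(U, V); then N(U, V1) and N(U, V2); then N(U, U) and
    N(V1, V2); then N(A, B) and N(C, D).  Apart from the third, each step
    replaces the source U of a pair by U `&` f^-k V, for k in N(U, V), which
    turns a return time n of the new set into the hitting time n + k from U to
    V.  Surjectivity keeps these preimages nonempty. *)
Lemma weakly_mixing_of_return_differences (T : topologicalType) (f : T -> T) :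
  continuous f -> set_surj [set: T] [set: T] f -> transitive_map f ->
  (forall (W : set T) k, open W -> W !=set0 -> exists n,
     hitting_times f W W n /\ hitting_times f W W (n + k)) ->
  weakly_mixing f.
Proof.
move=> cf sf tr ret.
have opre n U : open U -> open (iter n f @^-1` U).
  by move=> oU; move/continuousP: (@continuous_iter _ _ n cf); exact.
have nepre n U : U !=set0 -> iter n f @^-1` U !=set0.
  move=> [u Uu]; suff [v vu] : exists v, iter n f v = u.
    by exists v => /=; rewrite vu.
  elim: n => [|n [v <-]]; first by exists u.
  by have [v' _ <-] := sf v I; exists v'; rewrite -iterSr.
have transit U V : open U -> U !=set0 -> open V -> V !=set0 ->
    exists k, [/\ (0 < k)%N, open (U `&` iter k f @^-1` V) &
      U `&` iter k f @^-1` V !=set0].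
  move=> oU U0 oV V0; have [k /hitting_timesP[k0 [x Ux Vx]]] := tr U V oU U0 oV V0.
  exists k; split => //; last by exists x.
  by apply: openI => //; exact: opre.
have ret1 U V : open U -> U !=set0 -> open V -> V !=set0 ->
    exists2 n, hitting_times f U U n & hitting_times f U V n.
  move=> oU U0 oV V0; have [k [k0 oW W0]] := transit U V oU U0 oV V0.
  have [n [/hitting_timesP[n0 [x [Ux _] [_ Vx]]] ]] := ret _ k oW W0.
  move=> /hitting_timesP[nk0 [y [Uy _] [Uny _]]].
  exists (n + k)%N; apply/hitting_timesP; split => //; first by exists y.
  by exists x => //; rewrite addnC iterD.
have ret2 U V1 V2 : open U -> U !=set0 -> open V1 -> V1 !=set0 ->
    open V2 -> V2 !=set0 ->
    exists2 n, hitting_times f U V1 n & hitting_times f U V2 n.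
  move=> oU U0 oV1 V10 oV2 V20; have [k [k0 oW W0]] := transit U V1 oU U0 oV1 V10.
  have [n] := ret1 _ (iter k f @^-1` V2) oW W0 (opre k _ oV2) (nepre k _ V20).
  move=> /hitting_timesP[n0 [x [Ux _] [_ Vx]]] /hitting_timesP[_ [y [Uy _] Vy]].
  exists (k + n)%N; apply/hitting_timesP; split; rewrite ?addn_gt0 ?k0//.
    by exists x => //; rewrite iterD.
  by exists y => //; rewrite iterD.
have ret3 U V1 V2 : open U -> U !=set0 -> open V1 -> V1 !=set0 ->
    open V2 -> V2 !=set0 ->
    exists2 n, hitting_times f U U n & hitting_times f V1 V2 n.
  move=> oU U0 oV1 V10 oV2 V20.
  have [n /hitting_timesP[n0 [x Ux Vx]] /hitting_timesP[_ [y Uy Vy]]] :=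
    ret2 U V1 V2 oU U0 oV1 V10 oV2 V20.
  (* The swap: if u and f^n u lie in U and V1, and f^m u and f^(n+m) u in U and
     V2, then m is a hitting time from U to U and from V1 to V2. *)
  have [m /hitting_timesP[m0 [u [Uu Vu] [Um Vm]]]] : hitting_times f
      (U `&` iter n f @^-1` V1) (U `&` iter n f @^-1` V2) !=set0.
    apply: tr; [|by exists x| |by exists y].
    - by apply: openI => //; exact: opre.
    - by apply: openI => //; exact: opre.
  exists m; apply/hitting_timesP; split => //; first by exists u.
  by exists (iter n f u) => //; rewrite -iterD addnC iterD.
have ret4 A B C D : open A -> A !=set0 -> open B -> B !=set0 ->
    open C -> C !=set0 -> open D -> D !=set0 ->
    exists2 n, hitting_times f A B n & hitting_times f C D n.
  move=> oA A0 oB B0 oC C0 oD D0; have [k [k0 oW W0]] := transit A B oA A0 oB B0.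
  have [n] := ret3 _ C (iter k f @^-1` D) oW W0 oC C0 (opre k _ oD) (nepre k _ D0).
  move=> /hitting_timesP[n0 [x [Ax _] [_ Bx]]] /hitting_timesP[_ [y Cy Dy]].
  exists (k + n)%N; apply/hitting_timesP; split; rewrite ?addn_gt0 ?k0//.
    by exists x => //; rewrite iterD.
  by exists y => //; rewrite iterD.
have box (U : set (T * T)) : open U -> U !=set0 -> exists A C : set T,
    [/\ open A, A !=set0, open C, C !=set0 & A `*` C `<=` U].
  move=> oU [[a c] Uac].
  have [[A C]/= [nA nC] ACU] : nbhs (a, c) U by exact: open_nbhs_nbhs.
  exists A°, C°; split;
    [exact: open_interior|by exists a|exact: open_interior|by exists c|].
  by move=> [x y] [/= /interior_subset Ax /interior_subset Cy]; exact: ACU.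
move=> U V oU U0 oV V0.
have [A [C [oA A0 oC C0 ACU]]] := box U oU U0.
have [B [D [oB B0 oD D0 BDV]]] := box V oV V0.
have [n /hitting_timesP[n0 [x Ax Bx]] /hitting_timesP[_ [y Cy Dy]]] :=
  ret4 A B C D oA A0 oB B0 oC C0 oD D0.
exists n; apply/hitting_timesP; split => //; exists (x, y); first exact: ACU.
apply: BDV; suff -> : iter n (fun p : T * T => (f p.1, f p.2)) (x, y) =
    (iter n f x, iter n f y) by [].
by elim: n {n0 Bx Dy} => //= n ->.
Qed.

Theorem theorem4p1 (R : realType) (X : pmetricType R) (f : X -> X) (alpha : R)
    (halpha0 : 0 < alpha) (halpha1 : alpha < 1)
    (hds : dynamical_system f) (hE : E_system f)
    (hsh : dense_shadowing alpha f) :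
  weakly_mixing f.
Proof.
have [cX cf sf] := hds; have [tr [mu mui mus]] := hE.
apply: weakly_mixing_of_return_differences => // W k oW W0.
exact: (return_time_differences k halpha0 cX cf hsh mui mus oW W0).
Qed.
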